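(* Let $W$ be a uniformly recurrent infinite word over a finite alphabet $A$ that is generated by a piecewise-continuous transformation of the interval. Then there exists an infinite word $W'$ over $A$ which is equivalent to $W$ and is generated by an interval exchange transformation.
   Context: **Words.** Words are infinite sequences $W=w_0w_1w_2\cdots$ of letters of $A$. A factor (subword) of $W$ is a finite block of consecutive letters. $W$ is uniformly recurrent if each of its factors occurs in it infinitely many times and for each factor $v$ there is $N(v)$ such that $v$ occurs in every factor of $W$ of length at least $N(v)$. Two infinite words are equivalent if they have the same set of finite factors. **Piecewise-continuous transformations.** Let $I=[0,1]$. A piecewise-continuous transformation $T$ of $I$ is given by points $0=x_0<x_1<\dots<x_m=1$ and $0=y_0<y_1<\dots<y_m=1$ and a permutation $\sigma$ of $\{0,\dots,m-1\}$, where $T$ maps $(x_i,x_{i+1})$ onto $(y_{\sigma(i)},y_{\sigma(i)+1})$ continuously and bijectively (hence monotonically, increasing or decreasing) for each $i$. An interval exchange transformation is such a $T$ that is an isometry on each $(x_i,x_{i+1})$ (a translation, possibly composed with the reflection of the interval about its midpoint). **Generated words.** Let $I$ be partitioned into characteristic sets $U_a$, $a\in A$, each a finite union of nondegenerate intervals. A point $x$ has evolution $v=v_0\cdots v_{n-1}$ if $T^i(x)$ is defined and $T^i(x)\in U_{v_i}$ for $0\le i<n$. A finite word $v$ is an essential finite evolution of a point $x^*$ if every neighborhood of $x^*$ contains a nonempty open set $V$ all of whose points have evolution $v$. An infinite word $W$ is an essential evolution of $x^*$ if every initial subword of $W$ is an essential finite evolution of $x^*$. $W$ is generated by $T$ if,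 for some such partition into characteristic sets (some of the $U_a$ may be empty), $W$ is an essential evolution of some point of $I$. *)

(* Defs.v *)
From mathcomp Require Import all_boot all_order all_algebra perm.
From mathcomp Require Import all_classical all_reals.
From mathcomp Require Import topology normedtype.

Set Implicit Arguments.
Unset Strict Implicit.
Unset Printing Implicit Defensive.

Import Order.TTheory GRing.Theory Num.Theory.
Import numFieldNormedType.Exports.

Local Open Scope classical_set_scope.
Local Open Scope ring_scope.

Section Words.
Variable A : finType.
Implicit Types (W : nat -> A) (v u : seq A).

Definition block W (i n : nat) : seq A := mkseq (fun j => W (i + j)%N) n.

Definition occurs_at W v (i : nat) : Prop := block W i (size v) = v.

Definition is_factor W v : Prop := exists i, occurs_at W v i.

Definition uniformly_recurrent W : Prop :=
  forall v, is_factor W v ->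
    (forall n : nat, exists i : nat, (n <= i)%N /\ occurs_at W v i) /\
    (exists N : nat, forall u, is_factor W u -> (N <= size u)%N -> infix v u).

Definition equivalent_words W W' : Prop :=
  forall v, is_factor W v <-> is_factor W' v.

End Words.

(* Only [pc_x 0 .. pc_x m], [pc_y 0 .. pc_y m] and the values of [pc_fun] on
   the open intervals of the subdivision are meaningful; the transformation is
   regarded as undefined at the subdivision points (see [pc_dom]). *)
Record pc_transformation (R : realType) := PCTransformation {
  pc_num : nat;
  pc_x : nat -> R;
  pc_y : nat -> R;
  pc_perm : 'S_pc_num;
  pc_fun :> R -> R;
  pc_x0 : pc_x 0%N = 0;
  pc_xm : pc_x pc_num = 1;
  pc_x_lt : forall i : nat, (i < pc_num)%N -> pc_x i < pc_x i.+1;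
  pc_y0 : pc_y 0%N = 0;
  pc_ym : pc_y pc_num = 1;
  pc_y_lt : forall i : nat, (i < pc_num)%N -> pc_y i < pc_y i.+1;
  pc_continuous : forall i : 'I_pc_num,
    {within `]pc_x i, pc_x i.+1[, continuous pc_fun};
  pc_bij : forall i : 'I_pc_num,
    set_bij `]pc_x i, pc_x i.+1[ `]pc_y (pc_perm i), pc_y (pc_perm i).+1[ pc_fun
}.

Section Dynamics.
Variable R : realType.
Implicit Types (T : pc_transformation R) (x : R).

Definition interval_exchange T : Prop :=
  forall i : 'I_(pc_num T),
    {in `]pc_x T i, pc_x T i.+1[ &, forall u v, `|T u - T v| = `|u - v|}.

Definition pc_dom T : set R :=
  [set x | exists i : 'I_(pc_num T), x \in `]pc_x T i, pc_x T i.+1[].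

Definition iter_defined T (n : nat) x : Prop :=
  x \in `[0, 1] /\ forall j : nat, (j < n)%N -> pc_dom T (iter j T x).

Definition nondegenerate_itv (J : interval R) : Prop :=
  exists a b : R, [/\ a \in J, b \in J & a < b].

Definition finite_union_of_itvs (U : set R) : Prop :=
  exists s : seq (interval R),
    (forall J, J \in s -> nondegenerate_itv J) /\
    U = [set x | exists2 J, J \in s & x \in J].

Variable A : finType.
Implicit Types (U : A -> set R) (v : seq A) (W : nat -> A).

(* The library's [partition] is not used because it forbids empty parts. *)
Definition characteristic_sets U : Prop :=
  [/\ \bigcup_a U a = `[0, 1]%classic,
      trivIset setT U &
      forall a, finite_union_of_itvs (U a)].

(* [a0] is only the default value of [nth]. *)
Definition has_evolution T U x v : Prop :=
  forall (a0 : A) (i : nat), (i < size v)%N ->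
    iter_defined T i x /\ U (nth a0 v i) (iter i T x).

(* Neighborhoods and open sets are those of the real line, with [V] inside
   [0, 1]; the topology induced on [0, 1] gives the same notion, as a nonempty
   relatively open subset of [0, 1] contains a nonempty open set of reals. *)
Definition essential_finite_evolution T U x v : Prop :=
  forall N : set R, nbhs x N ->
    exists V : set R,
      [/\ open V, V !=set0, V `<=` N `&` `[0, 1] &
          forall z, V z -> has_evolution T U z v].

Definition essential_evolution T U x W : Prop :=
  forall n : nat, essential_finite_evolution T U x (block W 0 n).

Definition generated_by T W : Prop :=
  exists2 U : A -> set R, characteristic_sets U &
    exists2 x : R, x \in `[0, 1] & essential_evolution T U x W.

End Dynamics.

(* Main.v *)
Require Import Defs.
From mathcomp Require Import all_boot all_order all_algebra perm.
From mathcomp Require Import all_classical all_reals.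
From mathcomp Require Import topology normedtype sequences realfun.
From mathcomp Require Import ring lra.

Set Implicit Arguments.
Unset Strict Implicit.
Unset Printing Implicit Defensive.

Import Order.TTheory GRing.Theory Num.Theory.
Import numFieldNormedType.Exports.

Local Open Scope classical_set_scope.
Local Open Scope ring_scope.

(** The transformation [T] is straightened into an interval exchange by an
    invariant mean. For each n the hypothesis gives a point [z n] whose orbit
    reads a prefix of [W] of length 2n. The frequencies with which the first n
    points of this orbit visit a set converge, along an ultrafilter, to a
    finitely additive probability [m] on the sets of reals, invariant under
    [T] ([mean_exists]). A set of positive mean meets these orbits, at points
    from which long factors of [W] can be read.

    Refine the pieces of continuity of [T] and the characteristic sets into
    finitely many convex cells [J b], each inside one piece and one
    characteristic set ([coding_exists]). Reparametrize the line by the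
    distribution function of [m]: the cell [J b] becomes the interval of length
    [m (J b)] whose left end is the mass on the left of [J b]. Since [m] is
    invariant, [T @` J b] has the same mass, and by the monotonicity of [T] on
    [J b] the map induced in the new coordinate is an isometry on each
    interval. As the images of the cells fill the line in their own order, it
    is an interval exchange ([exchange_exists]).

    More generally a cylinder, the set of points whose first cells spell a
    given word, is convex, and becomes an interval of length its mass. The
    exchange maps it into the interval of the shifted cylinder
    ([mean_itv_step]), so all its points read the same word. Choose letters one
    by one so that every prefix has a cylinder of positive mass; the intervals
    of these cylinders are nested, and a point in all their closures has the
    resulting word [W'] as an essential evolution ([exchange_realizes]).

    A factor of [W'] has a cylinder of positive mass, hence is read on some
    orbit of [z n] and is a factor of [W]. Uniform recurrence gives the
    converse inclusion ([equivalent_sub_factors]). Atoms of the mean, as when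
    [W] is periodic, become intervals and need no separate treatment. *)

(** * Invariant means *)

(** Finite additivity is all that the argument uses, so a mean may be defined
    on every set of points and no measurability question arises. *)
Record mean (R : realType) (X : Type) (m : set X -> R) : Prop := Mean {
  mean_ge0 : forall E, 0 <= m E;
  meanT : m setT = 1;
  meanU : forall E F, E `&` F = set0 -> m (E `|` F) = m E + m F }.

Section MeanTheory.
Variables (R : realType) (X : Type) (m : set X -> R).
Hypothesis m_mean : mean m.

Lemma mean0 : m set0 = 0.
Proof.
have := meanU m_mean (setI0 (set0 : set X)).
by rewrite setU0 -[LHS]addr0 => /addrI.
Qed.

Lemma mean_split (C E : set X) : m E = m (E `&` C) + m (E `&` ~` C).
Proof.
rewrite -(meanU m_mean) -?setIUr ?setUCr ?setIT //.
by rewrite setIACA setICr setI0.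
Qed.

Lemma mean_le (E F : set X) : E `<=` F -> m E <= m F.
Proof.
move=> EF; rewrite (mean_split E F) (setIidr EF) lerDl.
exact: mean_ge0.
Qed.

(** A set with null complement carries all the mass. *)
Lemma mean_conull (C E : set X) : m (~` C) = 0 -> m E = m (E `&` C).
Proof.
move=> C0; rewrite (mean_split C); have /eqP -> : m (E `&` ~` C) == 0.
  by rewrite eq_le (mean_ge0 m_mean) -C0 mean_le //; apply: subIsetr.
by rewrite addr0.
Qed.

Lemma mean_le_conull (C E F : set X) :
  m (~` C) = 0 -> E `&` C `<=` F -> m E <= m F.
Proof. by move=> /mean_conull -> /mean_le. Qed.

Lemma mean_bigcup (B : finType) (J : B -> set X) (E : set X) :
  trivIset setT J -> m (~` \bigcup_b J b) = 0 ->
  m E = \sum_b m (E `&` J b).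
Proof.
move=> Jdisj /mean_conull ->.
suff sumP (s : seq B) : uniq s ->
    m (E `&` [set x | exists2 b, b \in s & J b x]) =
    \sum_(b <- s) m (E `&` J b).
  rewrite -(sumP _ (index_enum_uniq B)); congr (m (E `&` _)).
  apply/seteqP; split=> x.
    by case=> b _ Jb; exists b; rewrite ?mem_index_enum.
  by case=> b _ Jb; exists b.
elim: s => [_|b s IHs /= /andP[bs us]].
  by rewrite big_nil -mean0; congr m; apply/seteqP; split=> // x [_ []].
rewrite big_cons -IHs // -meanU //.
  congr m; rewrite -setIUr; congr (_ `&` _); apply/seteqP; split=> x.
    case=> b'; rewrite inE => /orP[/eqP -> Jb|b's Jb]; first by left.
    by right; exists b'.
  case=> [Jb|[b' b's Jb]]; first by exists b; rewrite ?mem_head.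
  by exists b'; rewrite // inE b's orbT.
apply/seteqP; split=> // x [[_ Jb] [_ [b' bs' Jb']]].
have bb' := Jdisj b b' I I (ex_intro _ x (conj Jb Jb')).
by move: bs; rewrite bb' bs'.
Qed.

End MeanTheory.

(** Limits along the image of an ultrafilter are what turns compactness of
    [0, 1] into the convergence of every sequence of frequencies at once. *)
Lemma ultra_fmap (X Y : Type) (f : X -> Y) (F : set_system X) :
  UltraFilter F -> UltraFilter (f @ F).
Proof.
move=> FU; have FP : ProperFilter F by case: FU.
split=> [|H HP FH]; first exact: fmap_proper_filter.
apply/seteqP; split=> // E HE.
have [//|FnE] := in_ultra_setVsetC (f @^-1` E) FU.
exfalso; have HnE : H (~` E) by exact: FH.
apply: (filter_not_empty H); rewrite -(setICr E); exact: filterI.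
Qed.

Section MeanExistence.
Variables (R : realType) (X : Type) (T : X -> X) (z : nat -> X).

Definition hit (E : set X) (x : X) : R := `[< E x >]%:R.

Definition orbit_freq (E : set X) (n : nat) : R :=
  (\sum_(i < n) hit E (iter i T (z n))) / n%:R.

Lemma hit_ge0 E x : 0 <= hit E x. Proof. exact: ler0n. Qed.
Lemma hit_le1 E x : hit E x <= 1. Proof. by rewrite /hit; case: asbool. Qed.

Lemma hitU E F x : E `&` F = set0 -> hit (E `|` F) x = hit E x + hit F x.
Proof.
move=> EF; rewrite /hit -natrD; congr (_%:R).
case: (asboolP (E x)) => Ex; case: (asboolP (F x)) => Fx.
- by have : (E `&` F) x by []; rewrite EF.
- by apply/eqP; rewrite eqb1; apply/asboolP; left.
- by apply/eqP; rewrite eqb1; apply/asboolP; right.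
- by apply/eqP; rewrite eqb0; apply/asboolPn => -[].
Qed.

Lemma orbit_freq_ge0 E n : 0 <= orbit_freq E n.
Proof.
by apply: divr_ge0; rewrite ?ler0n ?sumr_ge0 // => i _; exact: hit_ge0.
Qed.

Lemma orbit_freq_le1 E n : orbit_freq E n <= 1.
Proof.
case: n => [|n]; first by rewrite /orbit_freq big_ord0 mul0r.
rewrite ler_pdivrMr ?ltr0n // mul1r.
have -> : n.+1%:R = \sum_(i < n.+1) 1 :> R by rewrite sumr_const card_ord.
by apply: ler_sum => i _; exact: hit_le1.
Qed.

Lemma orbit_freqU E F n : E `&` F = set0 ->
  orbit_freq (E `|` F) n = orbit_freq E n + orbit_freq F n.
Proof.
move=> EF; rewrite /orbit_freq -mulrDl -big_split /=; congr (_ / _).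
by apply: eq_bigr => i _; exact: hitU.
Qed.

(** The sum over an orbit segment telescopes against its shift, leaving a
    boundary term of order 1/n: this is why a limit of frequencies is
    invariant. *)
Lemma orbit_freq_shift E n :
  orbit_freq (T @^-1` E) n = orbit_freq E n
    + (hit E (iter n T (z n)) - hit E (z n)) / n%:R.
Proof.
rewrite /orbit_freq -mulrDl; congr (_ / _).
pose h i := hit E (iter i T (z n)).
have sum_shift k : \sum_(i < k) h i.+1 = \sum_(i < k) h i + (h k - h 0%N).
  elim: k => [|k IHk]; first by rewrite !big_ord0 subrr addr0.
  by rewrite big_ord_recr IHk big_ord_recr /=; ring.
exact: sum_shift.
Qed.

(** The Krylov-Bogolyubov construction, with frequencies along orbit segments
    of varying base point, and limits along one ultrafilter finer than the
    cofinite one. The second conclusion says where the mass can lie: a set of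
    positive mean is visited by arbitrarily long segments. *)
Lemma mean_exists : exists2 m : set X -> R,
  mean m /\ (forall E, m (T @^-1` E) = m E) &
  forall E, 0 < m E ->
    forall N, exists n i, [/\ (N <= n)%N, (i < n)%N & E (iter i T (z n))].
Proof.
have [G [GU ooG]] := @ultraFilterLemma _ (\oo : set_system nat) _.
have GP : ProperFilter G by case: GU.
have cvgG E : exists p : R, orbit_freq E @ G --> p.
  have := @segment_compact R 0 1; rewrite compact_ultra.
  move=> /(_ (orbit_freq E @ G) (ultra_fmap _ GU))[|p [_ Ep]]; last by exists p.
  apply: (@filterE _ G _) => n /=.
  by rewrite in_itv /= orbit_freq_ge0 orbit_freq_le1.
have [m mP] := choice cvgG.
have limE E p : orbit_freq E @ G --> p -> m E = p.
  exact: (cvg_unique (@norm_hausdorff _ _) (mP E)).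
have limoo (u : nat -> R) (p : R) : u @ \oo --> p -> u @ G --> p.
  by move=> up V /up; exact: ooG.
have mE0 E : (exists N, forall n, (N <= n)%N -> orbit_freq E n = 0) -> m E = 0.
  case=> N EN; apply/limE/limoo; apply: cvg_near_cst.
  by exists N => // n /= Nn; apply/eqP/EN.
exists m; first split; first split.
- move=> E; rewrite -(cvg_lim (@norm_hausdorff _ _) (mP E)).
  apply: limr_ge; first by apply/cvg_ex; exists (m E); exact: mP.
  by apply: nearW => n; exact: orbit_freq_ge0.
- apply/limE/limoo; apply: cvg_near_cst; exists 1%N => // n /= n0.
  have hitT x : hit setT x = 1 by rewrite /hit asboolT.
  rewrite /orbit_freq; under eq_bigr do rewrite hitT.
  by rewrite sumr_const card_ord divff // pnatr_eq0 -lt0n.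
- move=> E F EF; apply: limE.
  have -> : orbit_freq (E `|` F) = orbit_freq E \+ orbit_freq F.
    by apply/funext => n; exact: orbit_freqU.
  exact: cvgD.
- move=> E; apply: limE.
  have -> : orbit_freq (T @^-1` E) = orbit_freq E \+
      (fun n => (hit E (iter n T (z n)) - hit E (z n)) / n%:R).
    by apply/funext => n; exact: orbit_freq_shift.
  rewrite -[m E]addr0; apply: cvgD => //; apply: limoo.
  apply: norm_cvg0.
  apply: (@squeeze_cvgr _ _ _ _ (fun=> 0) (fun n => n%:R^-1)).
  + apply: nearW => n /=; rewrite normr_ge0 /= normrM -[leRHS]mul1r.
    rewrite [X in _ * X]ger0_norm ?invr_ge0 ?ler0n //.
    rewrite ler_wpM2r ?invr_ge0 ?ler0n //.
    have := hit_ge0 E (z n); have := hit_le1 E (z n).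
    have := hit_ge0 E (iter n T (z n)); have := hit_le1 E (iter n T (z n)).
    by rewrite ler_norml; move=> *; apply/andP; split; lra.
  + exact: cvg_cst.
  + by rewrite -cvg_shiftS; exact: cvg_harmonic.
- move=> E mE N; apply: contrapT => nE; move: mE; rewrite mE0 ?ltxx //.
  exists N => n Nn; rewrite /orbit_freq big1 ?mul0r // => i _.
  rewrite /hit; case: asboolP => // Ei; case: nE.
  by exists n, i.
Qed.
End MeanExistence.

(** * Interval exchanges from pairs of tilings *)

(** The intervals [l b, l b + lam b] are laid side by side from 0, each left
    end being the total length of the intervals placed before it. Two tilings
    with the same lengths differ by the order of their tiles. *)
Definition tiling (R : realType) (B : finType) (lam l : B -> R) : Prop :=
  injective l /\ forall b, l b = \sum_(b' | l b' < l b) lam b'.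

Section Tiling.
Variables (R : realType) (B : finType) (lam l : B -> R).
Hypotheses (lam_gt0 : forall b, 0 < lam b) (sum_lam : \sum_b lam b = 1).
Hypothesis l_tiling : tiling lam l.

Lemma card_below (b : B) : (#|[pred b' | (l b' < l b)%R]| < #|B|)%N.
Proof.
apply/proper_card/properP; split; first exact: subset_predT.
by exists b; rewrite // inE ltxx.
Qed.

(** The order of the left ends numbers the tiles, which yields both the
    increasing subdivision points and the permutation of an exchange. *)
Definition rank (b : B) : 'I_#|B| := Ordinal (card_below b).

Lemma ltn_rank b b' : (rank b < rank b')%N = (l b < l b')%R.
Proof.
case: (ltP (l b) (l b')) => [bb'|b'b].
  apply/proper_card/properP; split; last by exists b; rewrite !inE // ltxx.
  by apply/fintype.subsetP => c; rewrite !inE => /lt_trans; apply.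
apply/negbTE; rewrite -leqNgt; apply/subset_leq_card/fintype.subsetP => c.
by rewrite !inE => /lt_le_trans; apply.
Qed.

Lemma rank_inj : injective rank.
Proof.
move=> b b' bb'; apply: l_tiling.1; apply/eqP.
by rewrite eq_le !leNgt -!ltn_rank bb' ltnn.
Qed.

Lemma rank_bij : bijective rank.
Proof. by apply: inj_card_bij; rewrite ?card_ord //; exact: rank_inj. Qed.

Definition tile_pt (i : nat) : R := \sum_(b | (rank b < i)%N) lam b.

Lemma tile_pt0 : tile_pt 0 = 0.
Proof. exact: big_pred0. Qed.

Lemma tile_pt_card : tile_pt #|B| = 1.
Proof. by rewrite -sum_lam; apply: eq_bigl => b; rewrite ltn_ord. Qed.

Lemma tile_pt_rank b : tile_pt (rank b) = l b.
Proof. by rewrite l_tiling.2; apply: eq_bigl => b'; rewrite ltn_rank. Qed.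

Lemma tile_pt_rankS b : tile_pt (rank b).+1 = l b + lam b.
Proof.
rewrite -tile_pt_rank /tile_pt (bigD1 b) //= addrC; congr (_ + _).
apply: eq_bigl => b'; rewrite ltnS leq_eqVlt.
case: (eqVneq b' b) => [->|b'b]; first by rewrite ltnn andbF.
rewrite andbT -[X in X || _]/(rank b' == rank b).
by rewrite (inj_eq rank_inj) (negPf b'b).
Qed.

Lemma tile_pt_lt i : (i < #|B|)%N -> tile_pt i < tile_pt i.+1.
Proof.
move=> iB; have [unrank _ unrankK] := rank_bij.
rewrite -[i]/(val (Ordinal iB)) -(unrankK (Ordinal iB)).
by rewrite tile_pt_rank tile_pt_rankS ltrDl.
Qed.

Lemma tile_disjoint b b' x :
  x \in `]l b, l b + lam b[ -> x \in `]l b', l b' + lam b'[ -> b = b'.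
Proof.
have after c c' y : l c < l c' -> y \in `]l c, l c + lam c[ ->
    y \in `]l c', l c' + lam c'[ -> False.
  rewrite !in_itv /= => cc' /andP[_ yc] /andP[c'y _].
  have : l c + lam c <= l c'.
    rewrite -tile_pt_rankS -tile_pt_rank /tile_pt.
    rewrite [leRHS](bigID (fun d => (rank d < (rank c).+1)%N)) /=.
    rewrite [X in _ <= X + _](eq_bigl (fun d => (rank d < (rank c).+1)%N)).
      by rewrite lerDl sumr_ge0 // => d _; exact: ltW.
    move=> d; rewrite andbC; case: ltnP => //= dc.
    by apply: leq_trans dc _; rewrite ltn_rank.
  by move=> /(lt_le_trans yc)/(lt_trans c'y); rewrite ltxx.
move=> xb xb'; apply: l_tiling.1; apply/eqP; rewrite eq_le !leNgt.
by apply/andP; split; apply/negP => /after; apply; eassumption.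
Qed.

End Tiling.

Section Exchange.
Variables (R : realType) (B : finType) (lam l l' : B -> R) (up : B -> bool).
Hypotheses (lam_gt0 : forall b, 0 < lam b) (sum_lam : \sum_b lam b = 1).
Hypotheses (l_tiling : tiling lam l) (l'_tiling : tiling lam l').

Definition tile_map b (x : R) : R :=
  l' b + (if up b then x - l b else lam b - (x - l b)).

Definition exchange_fun (x : R) : R :=
  if [pick b | x \in `]l b, l b + lam b[] is Some b then tile_map b x else 0.

Lemma exchange_funE b x :
  x \in `]l b, l b + lam b[ -> exchange_fun x = tile_map b x.
Proof.
move=> xb; rewrite /exchange_fun.
case: pickP => [b' xb'|/(_ b)]; last by rewrite xb.
by rewrite (tile_disjoint lam_gt0 l_tiling xb xb').
Qed.

Lemma tile_map_dist b x y : `|tile_map b x - tile_map b y| = `|x - y|.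
Proof.
rewrite /tile_map; case: (up b); last rewrite distrC; congr `|_|; ring.
Qed.

Lemma tile_map_bij b :
  set_bij `]l b, l b + lam b[ `]l' b, l' b + lam b[ (tile_map b).
Proof.
split.
- move=> x; rewrite /= !in_itv /= /tile_map => /andP[? ?].
  by case: (up b); apply/andP; split; lra.
- move=> x y _ _ xy; apply/eqP; rewrite -subr_eq0 -normr_eq0.
  by rewrite -(tile_map_dist b) xy subrr normr0.
- move=> y; rewrite /= !in_itv /= => /andP[? ?].
  exists (l b + (if up b then y - l' b else lam b - (y - l' b))).
    by rewrite /= in_itv /=; case: (up b); apply/andP; split; lra.
  by rewrite /tile_map; case: (up b); ring.
Qed.

Lemma tile_map_continuous b : continuous (tile_map b).
Proof.
move=> x; apply/(@cvgrPdist_lt _ R^o) => e e0; near=> y.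
rewrite tile_map_dist; near: y; exact: (@cvgr_dist_lt _ R^o).
Unshelve. all: by end_near. Qed.

(** Any two tilings of [0, 1] with the same lengths, with any choice of
    orientations, are related by an interval exchange; [e] is the position
    of a tile in the source order. *)
Lemma exchange_exists : exists T : pc_transformation R,
  exists e : B -> 'I_(pc_num T),
  [/\ interval_exchange T, bijective e,
      forall b, pc_x T (e b) = l b,
      forall b, pc_x T (e b).+1 = l b + lam b &
      forall b x, x \in `]l b, l b + lam b[ -> T x = tile_map b x].
Proof.
have [unrank rankK unrankK] := rank_bij l_tiling.
have sigma_inj : injective (fun i => rank l' (unrank i)).
  exact: inj_comp (rank_inj l'_tiling) (can_inj unrankK).
pose sigma := perm sigma_inj.
have xE (i : 'I_#|B|) : `]tile_pt lam l i, tile_pt lam l i.+1[%R =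
    `]l (unrank i), l (unrank i) + lam (unrank i)[%R :> interval R.
  by rewrite -{1 2}(unrankK i) tile_pt_rank ?tile_pt_rankS.
have cont (i : 'I_#|B|) :
    {within `]tile_pt lam l i, tile_pt lam l i.+1[, continuous exchange_fun}.
  rewrite xE; apply: (@subspace_eq_continuous _ _ _ (tile_map (unrank i))).
    by move=> x; rewrite inE => xi; apply/esym; exact: exchange_funE.
  exact/continuous_subspaceT/tile_map_continuous.
have bij (i : 'I_#|B|) : set_bij `]tile_pt lam l i, tile_pt lam l i.+1[
    `]tile_pt lam l' (sigma i), tile_pt lam l' (sigma i).+1[ exchange_fun.
  rewrite xE permE tile_pt_rank // tile_pt_rankS //.
  have [fun_ inj_ surj_] := tile_map_bij (unrank i); split.
  - by move=> x xi; rewrite (exchange_funE xi); exact: fun_.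
  - move=> x y; rewrite !inE => xi yi.
    by rewrite (exchange_funE xi) (exchange_funE yi); apply: inj_; rewrite inE.
  - by move=> y /surj_[x xi <-]; exists x; rewrite // (exchange_funE xi).
exists (PCTransformation (tile_pt0 lam l) (tile_pt_card l sum_lam)
  (tile_pt_lt lam_gt0 l_tiling) (tile_pt0 lam l') (tile_pt_card l' sum_lam)
  (tile_pt_lt lam_gt0 l'_tiling) cont bij).
exists (rank l); split => /=.
- move=> i x y; rewrite xE => xi yi.
  by rewrite /= (exchange_funE xi) (exchange_funE yi) tile_map_dist.
- by exists unrank.
- by move=> b; rewrite tile_pt_rank.
- by move=> b; rewrite tile_pt_rankS.
- exact: exchange_funE.
Qed.

End Exchange.

(** * Order on sets of reals *)

Section Order.
Variable R : realType.
Implicit Types (E F : set R) (x y : R).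

Definition before E F : Prop := forall x y, E x -> F y -> x < y.
Definition separated E F : Prop := before E F \/ before F E.
(** For a nonempty interval, [left_of], the interval itself and [right_of]
    cut the line in three. The mean of [left_of] serves as the distribution
    function at the left end; an atom at this end is counted on the left or in
    the interval, according to the side where the end belongs. *)
Definition left_of E : set R := [set x | forall y, E y -> x < y].
Definition right_of E : set R := [set x | forall y, E y -> y < x].

Lemma separated_disjoint E F x : separated E F -> E x -> F x -> False.
Proof.
by case=> EF Ex Fx; [have := EF _ _ Ex Fx|have := EF _ _ Fx Ex]; rewrite ltxx.
Qed.

Lemma separated_trivIset (B : Type) (S : B -> set R) :
  (forall b b', b <> b' -> separated (S b) (S b')) -> trivIset setT S.
Proof.
move=> Ssep b b' _ _ [x [Sb Sb']]; apply: contrapT => /Ssep.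
by move=> /separated_disjoint /(_ Sb Sb').
Qed.

Lemma notin_left_of E x : ~ left_of E x -> exists2 y, E y & y <= x.
Proof.
move=> nEx; apply: contrapT => H; apply: nEx => y Ey; rewrite ltNge.
by apply/negP => yx; apply: H; exists y.
Qed.

End Order.

Section Grid.
Variables (R : realType) (u : nat -> R) (n : nat).
Hypothesis u_lt : forall i, (i < n)%N -> u i < u i.+1.

Lemma grid_le j k : (j <= k)%N -> (k <= n)%N -> u j <= u k.
Proof.
elim: k => [|k IHk]; first by rewrite leqn0 => /eqP ->.
rewrite leq_eqVlt => /predU1P[-> //|jk] kn.
by apply: le_trans (IHk jk (ltnW kn)) (ltW (u_lt kn)).
Qed.

Lemma grid_separated (i j : 'I_n) : i != j ->
  separated `]u i, u i.+1[%classic `]u j, u j.+1[%classic.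
Proof.
have cell_before (h k : 'I_n) : (h < k)%N ->
    before `]u h, u h.+1[%classic `]u k, u k.+1[%classic.
  move=> hk x y; rewrite /= !in_itv /= => /andP[_ xh] /andP[ky _].
  exact: lt_trans (lt_le_trans xh (grid_le hk (ltnW (ltn_ord k)))) ky.
by rewrite neq_ltn => /orP[] ij; [left|right]; exact: cell_before.
Qed.

End Grid.

(** * Characteristic sets made of pieces *)

Section Pieces.
Variables (R : realType) (A : finType) (T : pc_transformation R).
Implicit Types (i j : 'I_(pc_num T)).

(** Characteristic sets have to cover [0, 1] exactly, so each piece keeps its
    left end and the last one also keeps 1. *)
Definition piece_itv i : interval R :=
  Interval (BLeft (pc_x T i)) (BSide (i.+1 < pc_num T)%N (pc_x T i.+1)).

Lemma piece_itvE i x : (x \in piece_itv i) =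
  (pc_x T i <= x) &&
  (if (i.+1 < pc_num T)%N then x < pc_x T i.+1 else x <= pc_x T i.+1).
Proof. by rewrite in_itv /=; case: (_ < _)%N. Qed.

Lemma mem_piece_itv i x :
  x \in `]pc_x T i, pc_x T i.+1[ -> x \in piece_itv i.
Proof.
rewrite piece_itvE in_itv /= => /andP[/ltW -> xi] /=.
by case: ifP => // _; exact: ltW.
Qed.

Lemma piece_itv_bound i x : x \in piece_itv i -> pc_x T i <= x <= pc_x T i.+1.
Proof. by rewrite piece_itvE => /andP[-> /=]; case: ifP => // _ /ltW. Qed.

Lemma piece_itv_disjoint i j x :
  x \in piece_itv i -> x \in piece_itv j -> i = j.
Proof.
wlog ij : i j / (i <= j)%N => [hwlog|].
  by case: (leqP i j) => [|/ltnW] ij xi xj; [|apply/esym]; exact: hwlog.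
move=> xi xj; apply/val_inj/eqP; rewrite eqn_leq ij leqNgt /=.
apply/negP => ltij; move: xi; rewrite piece_itvE.
rewrite (leq_ltn_trans ltij (ltn_ord j)) => /andP[_ xi].
have /andP[jx _] := piece_itv_bound xj.
have ijx := le_trans (grid_le (@pc_x_lt _ T) ltij (ltnW (ltn_ord j))) jx.
by have := lt_le_trans xi ijx; rewrite ltxx.
Qed.

Lemma piece_itv_cover x : x \in `[0, 1] -> exists i, x \in piece_itv i.
Proof.
rewrite in_itv /= => /andP[x0 x1].
have n0 : (0 < pc_num T)%N.
  rewrite lt0n; apply/eqP => n0; have := pc_xm T; rewrite n0 pc_x0 => /esym/eqP.
  by rewrite oner_eq0.
have ex0 : exists k, (k < pc_num T)%N && (pc_x T k <= x).
  by exists 0%N; rewrite n0 pc_x0.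
have bnd k : (k < pc_num T)%N && (pc_x T k <= x) -> (k <= pc_num T)%N.
  by case/andP => /ltnW.
case: (ex_maxnP ex0 bnd) => k /andP[kn kx] kmax.
exists (Ordinal kn); rewrite piece_itvE /= kx /=; case: ltnP => /= kn1.
  rewrite ltNge; apply/negP => xk1.
  by have := kmax k.+1; rewrite kn1 xk1 ltnn => /(_ isT).
have -> // : pc_x T k.+1 = 1.
by rewrite -(pc_xm T); congr (pc_x T _); apply/eqP; rewrite eqn_leq kn kn1.
Qed.

Definition piece_sets (c : 'I_(pc_num T) -> A) (a : A) : set R :=
  [set x | exists2 i, c i = a & x \in piece_itv i].

Lemma piece_sets_characteristic c : characteristic_sets (piece_sets c).
Proof.
split.
- apply/seteqP; split=> x.
    case=> a _ [i _ /piece_itv_bound/andP[ix xi]]; rewrite /= in_itv /=.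
    rewrite -{1}(pc_x0 T) -(pc_xm T) (le_trans _ ix) ?(le_trans xi) //.
      by apply: (grid_le (@pc_x_lt _ T)) => //; exact: ltn_ord.
    by apply: (grid_le (@pc_x_lt _ T)) => //; exact: ltnW.
  by move=> /piece_itv_cover[i xi]; exists (c i) => //; exists i.
- move=> a a' _ _ [x [[i <- xi] [j <- xj]]].
  by rewrite (piece_itv_disjoint xi xj).
- move=> a.
  exists [seq piece_itv i | i <- enum 'I_(pc_num T) & c i == a]; split.
    move=> _ /mapP[i _ ->]; have lti := pc_x_lt (ltn_ord i).
    exists (pc_x T i), ((pc_x T i + pc_x T i.+1) / 2); split; last by lra.
      by rewrite piece_itvE lexx /=; case: ifP => // _; exact: ltW.
    by apply: mem_piece_itv; rewrite in_itv /=; apply/andP; split; lra.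
  apply/seteqP; split=> x /=.
    case=> i cia xi; exists (piece_itv i) => //.
    by apply/mapP; exists i; rewrite // mem_filter cia eqxx mem_enum.
  case=> K /mapP[i]; rewrite mem_filter => /andP[/eqP cia _] -> xi.
  by exists i.
Qed.

End Pieces.

(** * Reparametrization by a mean *)

Section MeanOrder.
Variables (R : realType) (m : set R -> R).
Hypothesis m_mean : mean m.
Implicit Types (E F : set R).

(** [mean_itv E] is what becomes of the interval [E] when the line is
    reparametrized by the distribution function of [m]; an atom of [m] is
    blown up into an interval of positive length. *)
Definition mleft E : R := m (left_of E).
Definition mean_itv E : interval R := `]mleft E, mleft E + m E[.

Lemma mean_gt0_neq0 E : 0 < m E -> E !=set0.
Proof.
move=> E_gt0; apply/set0P/eqP => E_empty; move: E_gt0.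
by rewrite E_empty mean0 // ltxx.
Qed.

Lemma mleft_leftD E F : is_interval F -> E `<=` F -> E !=set0 ->
  mleft E = mleft F + m (F `&` left_of E).
Proof.
move=> Fi EF [e Ee]; rewrite /mleft -(meanU m_mean).
  congr m; apply/seteqP; split=> x /=.
    move=> xE; have [xF|nxF] := pselect (left_of F x); [by left|right].
    have [y Fy yx] := notin_left_of nxF.
    split=> //; apply: (Fi y e) => //; first exact: EF.
    by rewrite yx /= ltW // xE.
  by case=> [xF y /EF/xF|[]].
by apply/seteqP; split=> // x [xF [Fx _]]; have := xF _ Fx; rewrite ltxx.
Qed.

Lemma mean_left_right E F : is_interval E -> E `<=` F -> E !=set0 ->
  m F = m (F `&` left_of E) + m E + m (F `&` right_of E).
Proof.
move=> Ei EF [e Ee]; rewrite -(meanU m_mean) -?(meanU m_mean).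
- congr m; apply/seteqP; split=> x; last first.
    by case=> [[[]|/EF]|[]].
  move=> Fx; have [xE|/notin_left_of[y Ey yx]] := pselect (left_of E x).
    by left; left.
  have [Ex|nEx] := pselect (E x); [by left; right|right; split=> //].
  move=> w Ew; rewrite ltNge; apply/negP => xw; apply: nEx.
  by apply: (Ei y w) => //; rewrite yx.
- apply/seteqP; split=> // x [[[_ xE]|Ex] [_ Ex']].
    by have := lt_trans (xE _ Ee) (Ex' _ Ee); rewrite ltxx.
  by have := Ex' _ Ex; rewrite ltxx.
- by apply/seteqP; split=> // x [[_ xE] Ex]; have := xE _ Ex; rewrite ltxx.
Qed.

(** Reparametrization preserves inclusion of intervals. *)
Lemma mean_itvS E F : is_interval E -> is_interval F -> E `<=` F -> E !=set0 ->
  mleft F <= mleft E /\ mleft E + m E <= mleft F + m F.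
Proof.
move=> Ei Fi EF E0; rewrite (mleft_leftD Fi EF E0) (mean_left_right Ei EF E0).
have := mean_ge0 m_mean (F `&` left_of E).
have := mean_ge0 m_mean (F `&` right_of E).
by split; lra.
Qed.

Lemma mean_itv01 E : mleft E + m E <= 1.
Proof.
rewrite -(meanT m_mean) -(meanU m_mean); first exact: mean_le.
by apply/seteqP; split=> // x [xE Ex]; have := xE _ Ex; rewrite ltxx.
Qed.

(** All the mass sits on the sets [S b], so what lies to the left of one of
    them is, up to a null set, the union of those that precede it. *)
Lemma mean_tiling (B : finType) (S : B -> set R) :
  (forall b b', b != b' -> separated (S b) (S b')) ->
  (forall b, 0 < m (S b)) -> m (~` \bigcup_b S b) = 0 ->
  tiling (m \o S) (mleft \o S).
Proof.
move=> Ssep S_gt0 S_conull.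
have mleft_lt b b' : before (S b) (S b') -> mleft (S b) < mleft (S b').
  move=> bb'; apply: (@lt_le_trans _ _ (mleft (S b) + m (S b))).
    by rewrite ltrDl.
  rewrite /mleft -(meanU m_mean); last first.
    by apply/seteqP; split=> // x [xE Ex]; have := xE _ Ex; rewrite ltxx.
  have [y Sy] := mean_gt0_neq0 (S_gt0 b).
  apply: mean_le => // x [xb|bx] w b'w; last exact: bb'.
  exact: lt_trans (xb _ Sy) (bb' _ _ Sy b'w).
split=> [b b' /= bb'|b /=].
  apply/eqP; apply: contraT => /Ssep[] /mleft_lt; by rewrite bb' ltxx.
rewrite {1}/mleft (mean_bigcup m_mean _ _ S_conull); last first.
  by apply: separated_trivIset => b1 b2 /eqP; exact: Ssep.
rewrite [RHS]big_mkcond; apply: eq_bigr => b' _.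
have [->|b'b] := eqVneq b' b.
  rewrite ltxx -(mean0 m_mean); congr m; apply/seteqP; split=> // x [xb Sx].
  by have := xb _ Sx; rewrite ltxx.
have [bb'|bb'] := Ssep _ _ b'b.
  by rewrite mleft_lt // (setIidr _) // => x Sx y; exact: bb'.
rewrite ltNge ltW ?mleft_lt //= -(mean0 m_mean); congr m.
apply/seteqP; split=> // x [xb Sx]; have [y Sy] := mean_gt0_neq0 (S_gt0 b).
by have := lt_trans (xb _ Sy) (bb' _ _ Sy Sx); rewrite ltxx.
Qed.

End MeanOrder.

(** * The induced exchange *)

Section Core.
Variables (R : realType) (A B : finType) (c : B -> A).
Variables (T : R -> R) (J : B -> set R) (up : B -> bool) (m : set R -> R).
Hypotheses (m_mean : mean m) (m_inv : forall E, m (T @^-1` E) = m E).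
Hypotheses (J_itv : forall b, is_interval (J b))
  (J_gt0 : forall b, 0 < m (J b)).
Hypothesis J_conull : m (~` \bigcup_b J b) = 0.
Hypothesis T_mono : forall b x y, J b x -> J b y ->
  (T x < T y) = if up b then x < y else y < x.
Hypothesis J_sep : forall b b', b != b' -> separated (J b) (J b').
Hypothesis TJ_sep : forall b b', b != b' -> separated (T @` J b) (T @` J b').

Implicit Types (E F : set R) (a b : B) (v w : seq B).

Fixpoint cylinder v : set R :=
  if v is b :: w then J b `&` T @^-1` cylinder w else setT.

(** Monotonicity of [T] on each [J b] is what keeps cylinders convex, hence
    comparable with the order of the line. *)
Lemma cylinder_itv v : is_interval (cylinder v).
Proof.
elim: v => [|b v IHv] //= x y [Jx vx] [Jy vy] z /andP[xz zy].
have Jz : J b z by apply: (J_itv Jx Jy); rewrite xz.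
split=> //; rewrite /preimage /=; case upb: (up b).
  by apply: (IHv _ _ vx vy); rewrite !leNgt !(@T_mono b) // upb -!leNgt xz.
by apply: (IHv _ _ vy vx); rewrite !leNgt !(@T_mono b) // upb -!leNgt xz zy.
Qed.

Lemma cylinder_rcons v b :
  cylinder (rcons v b) = cylinder v `&` iter (size v) T @^-1` J b.
Proof.
elim: v => [|a v IHv] /=; first by rewrite setIC.
rewrite IHv preimage_setI setIA; congr (_ `&` _); apply/funext => x.
by rewrite /preimage /= -iterS iterSr.
Qed.

Lemma cylinder_cat v w :
  cylinder (v ++ w) `<=` iter (size v) T @^-1` cylinder w.
Proof.
elim: v w => [|a v IHv] w //= x [_ /IHv].
by rewrite /preimage /= -iterSr.
Qed.

Lemma cylinder_nth v x b0 i :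
  cylinder v x -> (i < size v)%N -> J (nth b0 v i) (iter i T x).
Proof.
elim: v x i => [//|b v IHv] x [|i] /= [Jx vx] // iv.
by rewrite -iterS iterSr; exact: IHv.
Qed.

Lemma mean_iter n E : m (iter n T @^-1` E) = m E.
Proof.
elim: n E => [//|n IHn] E; rewrite -[RHS](m_inv E) -(IHn (T @^-1` E)).
by congr m; apply/funext => x.
Qed.

Lemma J_disjoint : trivIset setT J.
Proof. by apply: separated_trivIset => b b' /eqP; exact: J_sep. Qed.

(** By invariance almost every point is in some [J b] also after [size v]
    steps. *)
Lemma cylinder_extend v :
  0 < m (cylinder v) -> exists b, 0 < m (cylinder (rcons v b)).
Proof.
move=> v_gt0; apply: contrapT => no_ext; move: v_gt0.
rewrite (@mean_bigcup _ _ _ m_mean _ (fun b => iter (size v) T @^-1` J b)) //.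
- rewrite big1 ?ltxx // => b _; apply/eqP; rewrite eq_le mean_ge0 // andbT.
  rewrite leNgt -cylinder_rcons; apply/negP => b_gt0.
  by apply: no_ext; exists b.
- move=> b b' _ _ [x [Jb Jb']]; apply: J_disjoint => //.
  by exists (iter (size v) T x).
- rewrite -[RHS]J_conull -[RHS](mean_iter (size v)); congr m.
Qed.

Lemma image_disjoint b x : J b x -> forall b', (T @` J b') (T x) -> b' = b.
Proof.
move=> Jx b' Tx; apply/eqP; apply: contraT => /TJ_sep/separated_disjoint.
by move=> /(_ (T x) Tx)[]; exists x.
Qed.

(** The preimage of [T @` J b] is [J b] up to a null set, since the images of
    distinct pieces are disjoint. Hence the images tile [0, 1] with the same
    lengths as the pieces. *)
Lemma mean_image b : m (T @` J b) = m (J b).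
Proof.
rewrite -m_inv (mean_conull m_mean _ J_conull); congr m.
apply/seteqP; split=> x.
  by move=> [Tx [b' _ Jx]]; rewrite (image_disjoint Jx Tx).
by move=> Jx; split; [exists x|exists b].
Qed.

Lemma image_conull : m (~` \bigcup_b T @` J b) = 0.
Proof.
apply/eqP; rewrite eq_le mean_ge0 // andbT -m_inv -J_conull mean_le //.
by move=> x nTx [b _ Jx]; apply: nTx; exists b => //; exists x.
Qed.

(** The interval exchange has one tile per letter: its tiles are placed like
    the sets [J b], and moved to where the images [T @` J b] are. *)
Definition len b : R := m (J b).
Definition src b : R := mleft m (J b).
Definition dst b : R := mleft m (T @` J b).

Lemma src_tiling : tiling len src.
Proof. exact: mean_tiling. Qed.

Lemma dst_tiling : tiling len dst.
Proof.
have -> : len = m \o (fun b => T @` J b).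
  by apply/funext => b /=; rewrite mean_image.
apply: mean_tiling => //; first by move=> b; rewrite mean_image.
exact: image_conull.
Qed.

Lemma sum_len : \sum_b len b = 1.
Proof.
rewrite -(meanT m_mean) (mean_bigcup m_mean _ J_disjoint J_conull).
by apply: eq_bigr => b _; rewrite setTI.
Qed.

Lemma cylinder_tail_gt0 a v : 0 < m (cylinder (a :: v)) -> 0 < m (cylinder v).
Proof.
by move=> /lt_le_trans; apply; rewrite -[leRHS]m_inv; apply: mean_le => // x [].
Qed.

Lemma mean_itv_head a v x : 0 < m (cylinder (a :: v)) ->
  x \in mean_itv m (cylinder (a :: v)) -> x \in `]src a, src a + len a[.
Proof.
move=> av_gt0; rewrite !in_itv /= => /andP[x1 x2].
have EJ : cylinder (a :: v) `<=` J a by move=> y [].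
have [lo hi] := mean_itvS m_mean (@cylinder_itv (a :: v)) (@J_itv a) EJ
  (mean_gt0_neq0 m_mean av_gt0).
by apply/andP; split; [exact: le_lt_trans lo x1|exact: lt_le_trans x2 hi].
Qed.

(** The exchange moves the tile of a cylinder into the tile of the cylinder of
    the shifted word. Inside [J a], the left end of the image of the tile is
    [dst a] plus the mass of the part [H] of [J a] that [T] sends to the left
    of the cylinder (its left part if [T] increases on [J a], its right part
    otherwise). By invariance this is the mass to the left of
    [T @` cylinder (a :: v)], and this image lies in [cylinder v]. *)
Lemma mean_itv_step a v x : 0 < m (cylinder (a :: v)) ->
  x \in mean_itv m (cylinder (a :: v)) ->
  tile_map len src dst up a x \in mean_itv m (cylinder v).
Proof.
set F := cylinder v; set E := cylinder (a :: v) => E_gt0.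
have [e Ee] := mean_gt0_neq0 m_mean E_gt0.
have E_itv : is_interval E := @cylinder_itv (a :: v).
have EJ : E `<=` J a by move=> y [].
have Je : J a e by exact: EJ.
have lenE := mean_left_right m_mean E_itv EJ (ex_intro _ e Ee).
have srcE := mleft_leftD m_mean (@J_itv a) EJ (ex_intro _ e Ee).
pose H := J a `&` if up a then left_of E else right_of E.
have H_lt y s : H y -> E s -> T y < T s.
  move=> [Jy yE] Es; rewrite (T_mono Jy (EJ _ Es)).
  by move: yE; case: (up a) => /(_ _ Es).
(* A point whose image is left of F is either in J a, and then in H, or it has
   its image left of the whole of T(J a), because images are separated. *)
have lo : mleft m F <= dst a + m H.
  rewrite /dst /mleft -(m_inv (left_of F)) -(m_inv (left_of (T @` J a))).
  apply: (@le_trans _ _ (m (T @^-1` left_of (T @` J a) `|` H))); last first.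
    rewrite (meanU m_mean) //; apply/seteqP; split=> // y [yT [Jy _]].
    by have := yT (T y) (ex_intro2 _ _ y Jy erefl); rewrite ltxx.
  apply: (mean_le_conull m_mean J_conull) => y [yF [b _ Jy]].
  have [bJ|ba] := eqVneq b a.
    right; rewrite /H bJ in Jy *; split=> //.
    by case upa: (up a) => s Es;
      have := yF _ Es.2; rewrite (T_mono Jy (EJ _ Es)) upa.
  left=> _ [s Js <-]; have [bT|aT] := TJ_sep ba.
    by apply: bT; [exists y|exists s].
  have Ty : (T @` J b) (T y) by exists y.
  have Te : (T @` J a) (T e) by exists e.
  by have := lt_trans (aT _ _ Te Ty) (yF _ Ee.2); rewrite ltxx.
(* The three sets on the left are disjoint, and T sends each of their points
   into F or to the left of F, since F is convex and contains T e. *)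
have hi : dst a + m H + m E <= mleft m F + m F.
  rewrite /dst /mleft -(m_inv (left_of (T @` J a))) -!(meanU m_mean).
  - rewrite -[leRHS]m_inv; apply: mean_le => // y /= Hy.
    have [Fy|nFy] := pselect (F (T y)); [by right|left=> s Fs].
    rewrite ltNge; apply/negP => sy. apply: nFy.
    case: Hy => [[yT|Hy]|[]//].
      apply: (@cylinder_itv v s (T e)) => //; first exact: Ee.2.
      by rewrite sy ltW // yT //; exists e.
    apply: (@cylinder_itv v s (T e)) => //; first exact: Ee.2.
    by rewrite sy ltW // H_lt.
  - apply/seteqP; split=> // y [yF Fy].
    by have := yF _ Fy; rewrite ltxx.
  - apply/seteqP; split=> // y [[yT|Hy] Ey].
      have := yT (T y) (ex_intro2 _ _ y (EJ _ Ey) erefl); by rewrite ltxx.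
    by have := H_lt _ _ Hy Ey; rewrite ltxx.
  - apply/seteqP; split=> // y [yT [Jy _]].
    by have := yT (T y) (ex_intro2 _ _ y Jy erefl); rewrite ltxx.
move: lo hi lenE srcE; rewrite !in_itv /= /tile_map /H /src /len.
by case: (up a) => lo hi lenE srcE /andP[x1 x2]; apply/andP; split; lra.
Qed.

Lemma cylinder_word : exists omega : nat -> B,
  forall n, 0 < m (cylinder (mkseq omega n)).
Proof.
have m1 : 0 < m (cylinder [::]) by rewrite /= meanT.
have [b0 _] := cylinder_extend m1.
have [g gP] : exists g : seq B -> B,
    forall v, 0 < m (cylinder v) -> 0 < m (cylinder (rcons v (g v))).
  have /choice[g gP] : forall v, exists b,
      0 < m (cylinder v) -> 0 < m (cylinder (rcons v b)).
    move=> v; have [/cylinder_extend[b vb]|nv] := pselect (0 < m (cylinder v)).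
      by exists b.
    by exists b0 => /nv.
  by exists g.
pose prefix n := iter n (fun v => rcons v (g v)) [::].
exists (fun n => g (prefix n)) => n.
have -> : mkseq (fun n => g (prefix n)) n = prefix n.
  by elim: n => [//|n IHn]; rewrite mkseqS IHn.
by elim: n => [//|n IHn]; exact: gP.
Qed.

(** The closures of the tiles of the prefixes are nested. The common point may
    be an end of these tiles; this is harmless, an essential evolution being
    read on open sets close to the point. *)
Lemma nested_point (omega : nat -> B) :
  (forall n, 0 < m (cylinder (mkseq omega n))) ->
  exists x, forall n, mleft m (cylinder (mkseq omega n)) <= x <=
    mleft m (cylinder (mkseq omega n)) + m (cylinder (mkseq omega n)).
Proof.
move=> omega_gt0; pose C n := cylinder (mkseq omega n).
pose lo n := mleft m (C n); pose hi n := lo n + m (C n).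
have nest n : lo n <= lo n.+1 /\ hi n.+1 <= hi n.
  apply: mean_itvS => //; rewrite ?/C; try exact: cylinder_itv.
    by rewrite mkseqS cylinder_rcons; exact: subIsetl.
  exact: mean_gt0_neq0 (omega_gt0 n.+1).
have lo_le : {homo lo : n k / (n <= k)%N >-> n <= k}.
  by apply: homo_leq => // [? ? ?|n]; [exact: le_trans|exact: (nest n).1].
have hi_ge : {homo hi : n k / (n <= k)%N >-> k <= n}.
  apply: (@homo_leq _ hi (fun s t => t <= s)) => // [? ? ? ts rt|n].
    exact: le_trans rt ts.
  exact: (nest n).2.
have lo_hi n k : lo n <= hi k.
  apply: le_trans (lo_le _ _ (leq_addr k n)) _.
  apply: le_trans (hi_ge _ _ (leq_addl n k)).
  by rewrite lerDl mean_ge0.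
have lo_sup : has_sup (range lo).
  by split; [exists (lo 0%N), 0%N|exists (hi 0%N) => _ [n _ <-]].
exists (sup (range lo)) => n; apply/andP; split.
  by apply: sup_upper_bound => //; exists n.
by apply: ge_sup; [exact: lo_sup.1|move=> _ [k _ <-]; exact: lo_hi].
Qed.

(** By [mean_itv_step], every point of the open tile of a cylinder follows the
    word of this cylinder under the exchange. *)
Lemma exchange_realizes : exists (omega : nat -> B) (T' : pc_transformation R),
  [/\ forall n, 0 < m (cylinder (mkseq omega n)),
      interval_exchange T' & generated_by T' (c \o omega)].
Proof.
have [omega omega_gt0] := cylinder_word.
have [x xP] := nested_point omega_gt0.
have [T' [e [T'_iso [e' eK _] xe xeS T'E]]] :=
  exchange_exists up J_gt0 sum_len src_tiling dst_tiling.
exists omega, T'; split=> //.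
have mean_itv_01 v z : z \in mean_itv m (cylinder v) -> z \in `[0, 1].
  rewrite !in_itv /= => /andP[z1 z2]; rewrite !ltW //.
    by apply: lt_le_trans z2 _; exact: (mean_itv01 m_mean).
  by apply: le_lt_trans z1; exact: (mean_ge0 m_mean).
have evol v z : 0 < m (cylinder v) -> z \in mean_itv m (cylinder v) ->
    has_evolution T' (piece_sets (c \o e')) z (map c v).
  elim: v z => [//|a v IHv] z av_gt0 zav a0 i iv.
  have z01 := mean_itv_01 _ _ zav.
  have za := mean_itv_head av_gt0 zav.
  have zpc : z \in `]pc_x T' (e a), pc_x T' (e a).+1[ by rewrite xe xeS.
  have zdom : pc_dom T' z by exists (e a).
  case: i iv => [|i] iv.
    split; first by split.
    by exists (e a); [rewrite /= eK|exact: mem_piece_itv].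
  have T'z : T' z \in mean_itv m (cylinder v).
    by rewrite (T'E _ _ za); exact: mean_itv_step.
  have [[_ defT'z] UT'z] := IHv _ (cylinder_tail_gt0 av_gt0) T'z a0 i iv.
  split; last by rewrite iterSr.
  by split=> // -[//|j] ji; rewrite iterSr; exact: defT'z.
exists (piece_sets (c \o e')); first exact: piece_sets_characteristic.
exists x.
  have /andP[x1 x2] := xP 0%N; rewrite in_itv /=; apply/andP; split.
    by apply: le_trans x1; exact: (mean_ge0 m_mean).
  by apply: le_trans x2 _; exact: (mean_itv01 m_mean).
move=> n N /nbhs_ballP[eps /= eps_gt0 epsN].
have -> : block (c \o omega) 0 n = map c (mkseq omega n).
  by rewrite /block /mkseq -map_comp.
have /andP[x1 x2] := xP n; have C_gt0 := omega_gt0 n.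
set C := cylinder (mkseq omega n) in x1 x2 C_gt0.
pose l := Num.max (x - eps) (mleft m C).
pose r := Num.min (x + eps) (mleft m C + m C).
have lr : l < r.
  by rewrite /l /r gt_max !lt_min; do ! (apply/andP; split); lra.
exists [set` `]l, r[]; split.
- exact: interval_open.
- by exists ((l + r) / 2); rewrite /= in_itv /=; apply/andP; split; lra.
- move=> z; rewrite /= in_itv /= /l /r gt_max lt_min.
  move=> /andP[/andP[z1 z2] /andP[z3 z4]]; split.
    by apply: epsN; rewrite /ball /= ltr_norml; apply/andP; split; lra.
  by apply: (mean_itv_01 (mkseq omega n)); rewrite in_itv /= z2 z4.
- move=> z; rewrite /= in_itv /= /l /r gt_max lt_min.
  move=> /andP[/andP[z1 z2] /andP[z3 z4]].
  by apply: evol => //; rewrite in_itv /= z2 z4.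
Qed.

End Core.

(** * Coding by monotone cells *)

Section Signature.
Variables (R : realType) (S : seq (interval R)).
Implicit Types (x y : R).

(** Each interval of the list gives two cuts of the line, at its left and at
    its right end. Cuts are initial segments, so points with different
    signatures are separated by one of them, and whether a point belongs to
    the interval can be read from its two cuts. The default interval of [nth]
    is never reached. *)
Definition cut (k : 'I_(size S) * bool) : set R :=
  let K := [set` nth `]0, 0[ S k.1] in
  if k.2 then left_of K else [set x | exists2 y, K y & x <= y].

Definition signature x : {ffun 'I_(size S) * bool -> bool} :=
  [ffun k => `[< cut k x >]].

Definition signature_cell s : set R := [set x | signature x = s].

Lemma cut_le k x y : x <= y -> cut k y -> cut k x.
Proof.
rewrite /cut; case: k.2 => xy.
  by move=> yK z Kz; exact: le_lt_trans (yK _ Kz).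
by case=> z Kz yz; exists z => //; exact: le_trans yz.
Qed.

Lemma signature_cell_itv s : is_interval (signature_cell s).
Proof.
move=> x y <- ys z /andP[xz zy]; apply/ffunP => k.
move/ffunP: ys => /(_ k); rewrite !ffunE => yx.
apply: asbool_equiv_eq; split; first exact: cut_le.
by move=> /asboolP; rewrite -yx => /asboolP; exact: cut_le.
Qed.

Lemma signature_cell_separated s s' : s != s' ->
  separated (signature_cell s) (signature_cell s').
Proof.
move=> ss'; have [k sk] : exists k, s k != s' k.
  apply: contrapT => H; move/eqP: ss'; apply; apply/ffunP => k.
  by apply/eqP; apply: contraT => sk; case: H; exists k.
have cut_lt x y : cut k x -> ~ cut k y -> x < y.
  by move=> xk yk; rewrite ltNge; apply/negP => /cut_le/(_ xk).
have cellE t x : signature_cell t x -> t k = `[< cut k x >].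
  by move=> <-; rewrite ffunE.
move: sk; case sk: (s k); case s'k: (s' k) => // _; [left|right];
  move=> x y /cellE + /cellE; rewrite sk s'k => /esym/asboolP xk /esym/asboolPn;
  exact: cut_lt.
Qed.

Lemma signature_mem K x y :
  K \in S -> signature x = signature y -> x \in K -> y \in K.
Proof.
move=> KS xy xK; have iS : (index K S < size S)%N by rewrite index_mem.
have nK : nth `]0, 0[ S (Ordinal iS) = K by rewrite nth_index.
have cutE b : cut (Ordinal iS, b) x <-> cut (Ordinal iS, b) y.
  move/ffunP: xy => /(_ (Ordinal iS, b)); rewrite !ffunE.
  exact: asbool_eq_equiv.
have [z zK yz] : cut (Ordinal iS, false) y.
  by apply/cutE; rewrite /cut /= nth_index //; exists x.
have : ~ cut (Ordinal iS, true) y.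
  by move=> /cutE; rewrite /cut /= nth_index // => /(_ x xK); rewrite ltxx.
rewrite {1}/cut /= in zK *.
rewrite nth_index // in zK * => /notin_left_of[w wK wy].
by apply: (@interval_is_interval _ K w z) => //; rewrite wy.
Qed.

End Signature.

Section Coding.
Variables (R : realType) (A : finType) (T : pc_transformation R).
Variable U : A -> set R.

Definition piece (i : 'I_(pc_num T)) : set R := [set` `]pc_x T i, pc_x T i.+1[].

Lemma piece_mono i : exists up : bool, forall x y, piece i x -> piece i y ->
  (T x < T y) = if up then x < y else y < x.
Proof.
have inj : {in `]pc_x T i, pc_x T i.+1[ &, injective T}.
  by have [_ + _] := pc_bij i => inj x y xi yi; apply: inj; rewrite inE.
have [inc|dec] := itv_continuous_inj_mono (@pc_continuous _ T i) inj.
- exists true => x y xi yi; have [xy|yx|->] := ltgtP x y.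
  + exact: inc.
  + by apply/negbTE; rewrite -leNgt ltW // inc.
  + exact: ltxx.
- exists false => x y xi yi; have [yx|xy|->] := ltgtP y x.
  + exact: dec.
  + by apply/negbTE; rewrite -leNgt ltW // dec.
  + exact: ltxx.
Qed.

(** The line is refined along the characteristic sets and the pieces of
    continuity. The cells need not be open: convexity and separation are the
    only features of intervals used later. Images of cells of distinct pieces
    are separated because the pieces have distinct target intervals, and those
    of cells of one piece because [T] is monotone there. *)
Lemma coding_exists : characteristic_sets U ->
  exists (B : finType) (c : B -> A) (J : B -> set R) (up : B -> bool),
  [/\ (forall b, is_interval (J b)) /\ (forall b, J b `<=` U (c b)),
      forall b x y, J b x -> J b y ->
        (T x < T y) = if up b then x < y else y < x,
      forall b b', b != b' -> separated (J b) (J b'),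
      forall b b', b != b' -> separated (T @` J b) (T @` J b') &
      forall a x, pc_dom T x -> U a x -> exists b, J b x].
Proof.
move=> [_ U_disj /choice[s sP]].
pose S := flatten [seq s a | a <- enum A].
have [up upP] := choice piece_mono.
have U_sig a x y : signature S x = signature S y -> U a x -> U a y.
  move=> xy; rewrite (sP a).2 => -[K Ks xK]; exists K => //.
  apply: signature_mem xy xK; apply/flattenP; exists (s a) => //.
  by rewrite map_f // mem_enum.
pose B : finType :=
  ({ffun 'I_(size S) * bool -> bool} * A * 'I_(pc_num T))%type.
pose J (b : B) := signature_cell b.1.1 `&` U b.1.2 `&` piece b.2.
have J_sep b b' : b != b' -> separated (J b) (J b').
  case: b b' => [[t a] i] [[t' a'] i'].
  have sub_sep E F E' F' :
      E `<=` E' -> F `<=` F' -> separated E' F' -> @separated R E F.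
    move=> EE FF [EF|FE]; [left|right] => x y.
      by move=> /EE Ex /FF Fy; exact: EF.
    by move=> /FF Fx /EE Ey; exact: FE.
  move=> bb'; have [tt'|tt'] := eqVneq t t'; last first.
    by apply: sub_sep (signature_cell_separated tt') => x [[]].
  have [ii'|ii'] := eqVneq i i'; last first.
    by apply: sub_sep (grid_separated (@pc_x_lt _ T) ii') => x [].
  (* Only the letters differ: one of the two cells is empty, as the signature
     of a point determines its letter. *)
  left=> x y [[xt xa] _] [[yt ya'] _]; case/eqP: bb'.
  have ya : U a y by apply: U_sig xa; rewrite xt yt.
  by rewrite tt' ii' (U_disj a a' I I (ex_intro _ y (conj ya ya'))).
exists B, (fun b => b.1.2), J, (fun b => up b.2); split=> //.
- split=> [[[t a] i]|b x [[_ //]]] x y [[xt xa] xi] [[yt ya] yi] z xzy.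
  have zt : signature_cell t z by exact: signature_cell_itv xzy.
  split; last exact: interval_is_interval xzy.
  by split=> //; apply: U_sig xa; rewrite xt zt.
- by move=> b x y [_ xb] [_ yb]; exact: upP.
- move=> [[t a] i] [[t' a'] i'] bb'; have [ii'|ii'] := eqVneq i i'; last first.
    have := grid_separated (@pc_y_lt _ T)
      (i := pc_perm T i) (j := pc_perm T i').
    rewrite (inj_eq perm_inj) => /(_ ii').
    have im k x : piece k x ->
        `]pc_y T (pc_perm T k), pc_y T (pc_perm T k).+1[%classic (T x).
      by move=> xk; have [fun_ _ _] := pc_bij k; exact: fun_.
    by case=> [YY|YY]; [left|right] => _ _ [x [_ xi] <-] [y [_ yi] <-];
      apply: YY; apply: im.
  have T_before b1 b2 : b1.2 = i -> b2.2 = i -> separated (J b1) (J b2) ->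
      separated (T @` J b1) (T @` J b2).
    move=> b1i b2i.
    by case upi: (up i) => -[JJ|JJ]; [left|right|right|left] =>
      _ _ [x Jx <-] [y Jy <-];
      have xi := Jx.2; have yi := Jy.2; rewrite ?b1i ?b2i in xi yi;
      rewrite (upP i) // upi; exact: JJ.
  by apply: T_before => //; exact: J_sep.
- move=> a x [i xi] Ua; exists (signature S x, a, i).
  by split.
Qed.

End Coding.

(** * Factors *)

Lemma mkseq_block_cat (B : finType) (u : nat -> B) i k :
  mkseq u (i + k) = mkseq u i ++ block u i k.
Proof.
rewrite /mkseq iotaD map_cat add0n; congr (_ ++ _).
by rewrite -[X in iota X k]addn0 iotaDl -map_comp.
Qed.

Lemma infix_factor (A : finType) (W : nat -> A) (v : seq A) i n :
  infix v (block W i n) -> is_factor W v.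
Proof.
move=> /infixP[s [t st]]; exists (i + size s)%N.
have n_size : (size s + size v <= n)%N.
  have : size (block W i n) = n by rewrite size_mkseq.
  by rewrite st !size_cat addnA => <-; rewrite leq_addr.
apply: (@eq_from_nth _ (W 0%N)) => [|j]; rewrite size_mkseq // => jv.
rewrite nth_mkseq // -addnA.
have lt_n : (size s + j < n)%N by apply: leq_trans n_size; rewrite ltn_add2l.
rewrite -(nth_mkseq (W 0%N) (fun j => W (i + j)%N) lt_n).
rewrite -/(block W i n) st nth_cat ltnNge leq_addr /= addKn.
by rewrite nth_cat jv.
Qed.

(** A uniformly recurrent word generates a minimal subshift: a word whose
    factors are among those of [W] has arbitrarily long ones, and a given
    factor of [W] occurs in all those that are long enough. *)
Lemma equivalent_sub_factors (A : finType) (W W' : nat -> A) :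
  uniformly_recurrent W -> (forall v, is_factor W' v -> is_factor W v) ->
  equivalent_words W W'.
Proof.
move=> Wrec WW' v; split=> [Wv|]; last exact: WW'.
have [_ [N NP]] := Wrec v Wv.
apply: (@infix_factor _ _ _ 0 N); apply: NP; last by rewrite size_mkseq.
by apply: WW'; exists 0%N; rewrite /occurs_at size_mkseq.
Qed.

(** All that the construction retains of an essential evolution: orbits of
    unbounded length that read [W]. The length [n.*2] leaves room to read a
    word of length at most [n] from any of the first [n] points. *)
Lemma typical_points (R : realType) (A : finType) (T : pc_transformation R)
    (U : A -> set R) (x : R) (W : nat -> A) :
  essential_evolution T U x W ->
  exists z : nat -> R, forall n i, (i < n.*2)%N ->
    pc_dom T (iter i T (z n)) /\ U (W i) (iter i T (z n)).
Proof.
move=> ess.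
suff /choice[z zP] : forall n, exists z, forall i, (i < n.*2)%N ->
    pc_dom T (iter i T z) /\ U (W i) (iter i T z) by exists z.
move=> n; have [V [_ [z Vz] _ Vev]] := ess n.*2.+1 setT filterT.
have ev i : (i <= n.*2)%N -> iter_defined T i z /\ U (W i) (iter i T z).
  move=> iv; have := Vev z Vz (W 0%N) i; rewrite size_mkseq ltnS => /(_ iv).
  by rewrite nth_mkseq.
exists z => i iv; split; last exact: (ev i (ltnW iv)).2.
by have [[_ defz] _] := ev _ (leqnn n.*2); exact: defz.
Qed.

Theorem theorem4p2 (R : realType) (A : finType) (W : nat -> A) :
  uniformly_recurrent W ->
  (exists T : pc_transformation R, generated_by T W) ->
  exists W' : nat -> A,
    equivalent_words W W' /\
    exists T' : pc_transformation R, interval_exchange T' /\ generated_by T' W'.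
Proof.
move=> Wrec [T [U charU [x _ ess]]].
have [z zP] := typical_points ess.
have [m [m_mean m_inv] m_gt0] := mean_exists R T z.
have [B0 [c0 [J0 [up0 [[J0_itv J0U] T_mono J0_sep TJ0_sep J0_cover]]]]] :=
  coding_exists T charU.
have J0_conull : m (~` \bigcup_b J0 b) = 0.
  apply/eqP; rewrite eq_le mean_ge0 // andbT leNgt.
  apply/negP => /m_gt0/(_ 0%N).
  move=> [n [i [_ lt_in nJ]]]; apply: nJ.
  have [domz Uz] : pc_dom T (iter i T (z n)) /\ U (W i) (iter i T (z n)).
    by apply: zP; rewrite -addnn ltn_addr.
  by have [b Jb] := J0_cover _ _ domz Uz; exists b.
have J0_disj : trivIset setT J0.
  by apply: separated_trivIset => b b' /eqP; exact: J0_sep.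
(* Cells of mean zero are dropped, for tiles must have positive length. *)
pose B : finType := {b : B0 | 0 < m (J0 b)}.
pose c (b : B) := c0 (val b); pose J (b : B) := J0 (val b).
pose up (b : B) := up0 (val b).
have J_conull : m (~` \bigcup_b J b) = 0.
  rewrite (mean_bigcup m_mean _ J0_disj J0_conull) big1 // => b _.
  have [b_gt0|b_le0] := ltP 0 (m (J0 b)).
    rewrite -(mean0 m_mean); congr m; apply/seteqP; split=> // y [nJy Jy].
    by apply: nJy; exists (exist _ b b_gt0).
  apply/eqP; rewrite eq_le mean_ge0 // andbT; apply: le_trans b_le0.
  by apply: mean_le => // y [].
have [||||||omega [T' [omega_gt0 T'_iso T'_gen]]] :=
  @exchange_realizes R A B c T J up m m_mean m_inv.
- by move=> b; exact: J0_itv.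
- by move=> b; exact: (valP b).
- exact: J_conull.
- by move=> b y w; exact: T_mono.
- by move=> b b' bb'; exact: J0_sep.
- by move=> b b' bb'; exact: TJ0_sep.
exists (c \o omega); split; last by exists T'.
apply: equivalent_sub_factors => // v [i vi].
pose u := block omega i (size v).
have u_gt0 : 0 < m (cylinder T J u).
  apply: lt_le_trans (omega_gt0 (i + size v)%N) _.
  rewrite mkseq_block_cat -[leRHS](mean_iter m_inv (size (mkseq omega i))).
  by apply: mean_le => //; exact: cylinder_cat.
(* The mean of the cylinder of u is positive, so u is read, with its letters,
   on one of the orbits that read W. *)
have [n [j [vn jn zj]]] := m_gt0 _ u_gt0 (size v).
exists j; rewrite /occurs_at -[RHS]vi.
apply: (@eq_from_nth _ (W 0%N)) => [|h]; rewrite !size_mkseq // => hv.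
rewrite !nth_mkseq //.
have := cylinder_nth (omega 0%N) zj; rewrite size_mkseq => /(_ h hv).
rewrite nth_mkseq // -iterD => /J0U Uc.
have [_ UW] : pc_dom T (iter (h + j) T (z n)) /\
    U (W (h + j)%N) (iter (h + j) T (z n)).
  by apply: zP; rewrite -addnn -addSn leq_add // ?(ltnW jn) // (leq_trans hv).
case: charU => _ U_disj _; rewrite addnC.
exact: (U_disj _ _ I I (ex_intro _ _ (conj UW Uc))).
Qed.
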